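(* Let $s\geq 1$ be an integer. Then there exists $n_0=n_0(s)$ such that for every $n\geq n_0$ and every $F_s$-minor-free graph $G$ of order $n$, $$q(G)\leq q(K_s\vee \overline{K}_{n-s}),$$ with equality if and only if $G=K_s\vee\overline{K}_{n-s}$ (up to isomorphism).
   Context: All graphs are finite, simple and undirected; the order of a graph is its number of vertices. For a graph $G$, $A(G)$ is its adjacency matrix, $D(G)$ is the diagonal matrix of its vertex degrees, $Q(G)=D(G)+A(G)$ is its signless Laplacian matrix, and $q(G)$, the signless Laplacian spectral radius, is the largest eigenvalue of $Q(G)$. $K_n$ is the complete graph on $n$ vertices, $\overline{G}$ is the complement of $G$ (so $\overline{K}_{m}$ is the edgeless graph on $m$ vertices), $kG$ is the disjoint union of $k$ copies of $G$, and $G\vee H$ is the join of vertex-disjoint graphs $G$ and $H$, obtained from their disjoint union by joining every vertex of $G$ to every vertex of $H$. The friendship graph $F_s=K_1\vee sK_2$ consists of $s$ triangles sharing one common vertex. A graph $H$ is a minor of $G$ if $H$ can be obtained from a subgraph of $G$ by contracting edges; $G$ is $H$-minor-free if $H$ is not a minor of $G$. *)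

(* Defs.v *)
From mathcomp Require Import all_boot all_order all_algebra.
From mathcomp Require Import classical_sets reals complex polyrcf.

Set Implicit Arguments.
Unset Strict Implicit.
Unset Printing Implicit Defensive.
Import Order.TTheory GRing.Theory Num.Theory.
Local Open Scope ring_scope.

Record sgraph := SGraph {
  vertex :> finType;
  adj : rel vertex;
  adj_sym : symmetric adj;
  adj_irr : irreflexive adj }.

Definition iso (G H : sgraph) : Prop :=
  exists2 f : G -> H, bijective f & forall x y, adj (f x) (f y) = adj x y.

Section Constructions.
Implicit Types G H : sgraph.

Fact complete_sym n : symmetric (fun x y : 'I_n => x != y).
Proof. by move=> x y; rewrite eq_sym. Qed.
Fact complete_irr n : irreflexive (fun x y : 'I_n => x != y).
Proof. by move=> x; rewrite eqxx. Qed.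
Definition complete n := SGraph (@complete_sym n) (@complete_irr n).

Definition compl_adj G : rel G := fun x y => (x != y) && ~~ adj x y.
Fact compl_sym G : symmetric (@compl_adj G).
Proof. by move=> x y; rewrite /compl_adj eq_sym adj_sym. Qed.
Fact compl_irr G : irreflexive (@compl_adj G).
Proof. by move=> x; rewrite /compl_adj eqxx. Qed.
Definition compl G := SGraph (@compl_sym G) (@compl_irr G).

Definition copies_adj k G : rel ('I_k * G)%type :=
  fun x y => (x.1 == y.1) && adj x.2 y.2.
Fact copies_sym k G : symmetric (@copies_adj k G).
Proof. by move=> x y; rewrite /copies_adj eq_sym adj_sym. Qed.
Fact copies_irr k G : irreflexive (@copies_adj k G).
Proof. by move=> x; rewrite /copies_adj adj_irr andbF. Qed.
Definition copies k G := SGraph (@copies_sym k G) (@copies_irr k G).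

Definition join_adj G H : rel (G + H)%type := fun x y =>
  match x, y with
  | inl u, inl v => adj u v
  | inr u, inr v => adj u v
  | _, _ => true
  end.
Fact join_sym G H : symmetric (@join_adj G H).
Proof. by move=> [x|x] [y|y] //=; rewrite adj_sym. Qed.
Fact join_irr G H : irreflexive (@join_adj G H).
Proof. by move=> [x|x] /=; rewrite adj_irr. Qed.
Definition join G H := SGraph (@join_sym G H) (@join_irr G H).

(* G / xy for an edge xy: y is deleted and its neighbours are passed on to x.
   Loops are excluded, and adj being a relation no multiple edge arises. *)
Definition contract_adj G (x y : G) : rel {v : G | v != y} := fun u v =>
  (u != v) &&
  [|| adj (val u) (val v),
      (val u == x) && adj y (val v) |
      (val v == x) && adj y (val u)].
Fact contract_sym G (x y : G) : symmetric (@contract_adj G x y).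
Proof.
move=> u v; rewrite /contract_adj eq_sym [adj (val v) _]adj_sym.
by congr (_ && (_ || _)); rewrite orbC.
Qed.
Fact contract_irr G (x y : G) : irreflexive (@contract_adj G x y).
Proof. by move=> u; rewrite /contract_adj eqxx. Qed.
Definition contract G (x y : G) :=
  SGraph (@contract_sym G x y) (@contract_irr G x y).

End Constructions.

Definition friendship s := join (complete 1) (copies s (complete 2)).

(* G' is isomorphic to a subgraph, not necessarily induced, of G. *)
Definition subgraph (G' G : sgraph) : Prop :=
  exists2 f : G' -> G, injective f & forall x y, adj x y -> adj (f x) (f y).

Inductive contracts_to (H : sgraph) : sgraph -> Prop :=
| contracts_done (G : sgraph) : iso G H -> contracts_to H G
| contracts_step (G : sgraph) (x y : G) :
    adj x y -> contracts_to H (contract x y) -> contracts_to H G.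

Definition minor (H G : sgraph) : Prop :=
  exists2 G', subgraph G' G & contracts_to H G'.

Definition minor_free (H G : sgraph) : Prop := ~ minor H G.

Section SignlessLaplacian.
Variable R : realType.

(* Rows and columns are indexed through the enumeration of the vertices. *)
Definition adjacency (G : sgraph) : 'M[R]_#|G| :=
  \matrix_(i, j) (adj (enum_val i) (enum_val j))%:R.

Definition degree_mx (G : sgraph) : 'M[R]_#|G| :=
  diag_mx (\row_i #|adj (enum_val i : G)|%:R).

Definition signless_laplacian (G : sgraph) : 'M[R]_#|G| :=
  degree_mx G + adjacency G.

Definition is_largest_eigenvalue n (A : 'M[R]_n) (a : R) : Prop :=
  eigenvalue A a /\ forall b, eigenvalue A b -> b <= a.

(* The default value 0 is used only for the graph without vertices: see qradP. *)
Definition qrad (G : sgraph) : R :=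
  xget 0 [set a | is_largest_eigenvalue (signless_laplacian G) a]%classic.

Lemma seq_max (s : seq R) a :
  a \in s -> exists2 c, c \in s & {in s, forall b, b <= c}.
Proof.
elim: s a => // d [|e s] IH a _.
  by exists d; rewrite ?mem_head // => b /[!inE] /eqP ->.
have [c cs cmax] := IH e (mem_head _ _).
exists (Num.max c d) => [|b].
  by rewrite inE; case: leP => _; rewrite ?eqxx // cs orbT.
by rewrite inE le_max => /orP[/eqP->|/cmax->]; rewrite ?lexx ?orbT.
Qed.

Lemma symmetric_largest_eigenvalue n (A : 'M[R]_n) :
  (0 < n)%N -> A^T = A -> exists a, is_largest_eigenvalue A a.
Proof.
move=> n0 As.
have [a Aa] : exists a, eigenvalue A a.
  have [z] := eigenvalue_closed (map_mx (real_complex R) A) n0.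
  move=> /[dup] Az /eigenvalueP[v vA v0].
  set B := map_mx _ _ in Az vA.
  have Breal : B \is a mxOver Num.real.
    by apply/mxOverP => i j; rewrite mxE complex_real.
  have BC : map_mx Num.conj B = B by exact: realmxC.
  have BT : B^T = B by rewrite /B map_trmx As.
  set w := (map_mx Num.conj v)^T.
  have Bw : B *m w = z^* *: w.
    by rewrite -BT -trmx_mul -BC -map_mxM vA map_mxZ linearZ.
  have vw0 : (v *m w) 0 0 != 0.
    rewrite mxE psumr_neq0; last by move=> i _; rewrite !mxE mul_conjC_ge0.
    have /rV0Pn[i vi] := v0.
    by apply/hasP; exists i; rewrite ?mem_index_enum //= !mxE mul_conjC_gt0.
  have zR : z \is Num.real.
    apply/CrealP; apply: (mulIf vw0).
    have : v *m B *m w = v *m (B *m w) by rewrite mulmxA.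
    rewrite vA Bw -scalemxAl -scalemxAr => /matrixP/(_ 0 0).
    by rewrite [LHS]mxE [RHS]mxE.
  have [r zr] : exists r, z = real_complex R r.
    by move/complex_realP: zR.
  exists r; rewrite eigenvalue_root_char.
  by rewrite eigenvalue_root_char zr /B -map_char_poly fmorph_root in Az.
have pn0 : char_poly A != 0 by rewrite monic_neq0 // char_poly_monic.
have rE b : eigenvalue A b = (b \in rootsR (char_poly A)).
  by rewrite -roots_on_rootsR // in_itv /= eigenvalue_root_char.
have [c cs cmax] := seq_max (etrans (esym (rE a)) Aa).
by exists c; split=> [|b]; rewrite rE //; apply: cmax.
Qed.

Lemma signless_laplacian_sym (G : sgraph) :
  (signless_laplacian G)^T = signless_laplacian G.
Proof.
rewrite /signless_laplacian linearD /= tr_diag_mx; congr (_ + _).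
by apply/matrixP => i j; rewrite !mxE adj_sym.
Qed.

Lemma qradP (G : sgraph) :
  (0 < #|G|)%N -> is_largest_eigenvalue (signless_laplacian G) (qrad G).
Proof.
move=> G0; apply: xgetPex.
exact: symmetric_largest_eigenvalue G0 (signless_laplacian_sym G).
Qed.

End SignlessLaplacian.

(* Main.v *)
Require Import Defs.
From mathcomp Require Import all_boot all_order all_algebra.
From mathcomp Require Import reals.
From mathcomp Require Import zify ring lra.

(* Let q(G) >= q(K_s v co-K_(n-s)) >= n + 2s - 5/2. Comparing an eigenvector with
   the degrees yields a vertex v with deg v + m(v) >= n + 2s - 5/2, where m(v) is
   the mean degree of the neighbours of v. The end of a longest path has all its
   neighbours on the path, so if it has 2s of them there is an F_s-minor; hence
   F_s-minor-free graphs have O(sn) edges, which forces deg v to be either O(s) or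
   n - O(s^2). Next to a vertex of degree n - O(s^2) at most s - 1 vertices can
   have degree larger than a constant, since otherwise it grows into the hub of an
   F_s-minor; counting edges then shows that v has degree n - 1 and that there are
   exactly s - 1 such vertices (if deg v = O(s), then s = 1 and the neighbour of v
   has degree n - 1). An edge avoiding these s vertices would complete an
   F_s-minor, so G is a subgraph of K_s v co-K_(n-s), and pairing with the positive
   eigenvector of the latter shows that no edge is missing. *)

Set Implicit Arguments.
Unset Strict Implicit.
Unset Printing Implicit Defensive.
Import Order.TTheory GRing.Theory Num.Theory.

(** * Minors from connected branch sets *)

Lemma connect_nontrivial (T : finType) (e : rel T) x y :
  connect e x y -> x != y -> exists z, e x z.
Proof.
case/connectP => [[|z p]] /= => [_ -> /eqP//|/andP[exz _] _ _].
by exists z.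
Qed.

Section Contraction.
Variables (G : sgraph) (x y : G).
Hypothesis xy : adj x y.

Fact contract_proj_subproof (v : G) : (if v == y then x else v) != y.
Proof.
case: (eqVneq v y) => // _; apply: contraTneq xy => ->.
by rewrite adj_irr.
Qed.

Definition contract_proj (v : G) : contract x y :=
  Sub (if v == y then x else v) (contract_proj_subproof v).

Lemma contract_projK (u : contract x y) : contract_proj (val u) = u.
Proof. by apply: val_inj; rewrite /= (negPf (valP u)). Qed.

Lemma contract_proj_adj a b : adj a b ->
  contract_proj a != contract_proj b ->
  adj (contract_proj a) (contract_proj b).
Proof.
move=> ab ne; rewrite /= /contract_adj ne /=.
case: (eqVneq a y) => [ay|ay]; case: (eqVneq b y) => [by_|by_].
- by rewrite ay by_ adj_irr in ab.
- by rewrite eqxx -ay ab orbT.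
- by rewrite eqxx -by_ (adj_sym b a) ab !orbT.
- by rewrite ab.
Qed.

End Contraction.

(** Induction on the order of [G]: a fiber with two vertices is connected, so it contains an edge;
    contracting that edge leaves a graph on which [f] is still defined with the same properties.
    Once [f] is injective it is an isomorphism. *)
Lemma contracts_to_fibers (H G : sgraph) (f : G -> H) :
  (forall h, exists x, f x = h) ->
  (forall x y, f x = f y -> connect (fun a b => adj a b && (f a == f b)) x y) ->
  (forall x y, adj x y -> f x != f y -> adj (f x) (f y)) ->
  (forall h k, adj h k -> exists x y, [/\ f x = h, f y = k & adj x y]) ->
  contracts_to H G.
Proof.
have [m] := ubnP #|G|; elim: m G f => // m IH G f Gm fS fC fA fE.
have [/injectiveP fI|/injectivePn[x [y xy fxy]]] := boolP (injectiveb f).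
  apply: contracts_done; exists f.
    apply: (inj_card_bij fI); rewrite -(card_codom fI).
    apply/subset_leq_card/subsetP => h _.
    by have [x <-] := fS h; apply: codom_f.
  move=> x y; apply/idP/idP => [/fE[a [b [/fI<- /fI<-]]]//|axy].
  apply: fA => //; rewrite (inj_eq fI); apply: contraTneq axy => ->.
  by rewrite adj_irr.
have [z /andP[axz /eqP fxz]] := connect_nontrivial (fC _ _ fxy) xy.
apply: (contracts_step axz).
pose pr := contract_proj axz.
have fpr a : f (val (pr a)) = f a by rewrite /=; case: eqP => [->|].
apply: (IH _ (fun u : contract x z => f (val u))).
- by rewrite /= card_sig -ltnS (leq_trans _ Gm) // ltnS (cardC1 z) prednK //;
    apply/card_gt0P; exists z.
- by move=> h; have [a fa] := fS h; exists (pr a); rewrite fpr.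
- move=> u w /fC /connectP[p]; rewrite -[in connect _ u _](contract_projK axz u).
  elim: p (val u) => [|b p IHp] a /=.
    by move=> _ wa; rewrite -wa contract_projK connect0.
  case/andP=> /andP[ab /eqP fab] pp lw; apply: connect_trans (IHp _ pp lw).
  have [e|ne] := eqVneq (pr a) (pr b); first by rewrite -/pr e connect0.
  apply: connect1; rewrite -/pr !fpr fab eqxx andbT.
  exact: contract_proj_adj ab ne.
- move=> u w /= /andP[_ /or3P[|/andP[/eqP-> aw]|/andP[/eqP-> aw]]].
  + exact: fA.
  + by rewrite fxz; apply: fA.
  + by rewrite fxz adj_sym eq_sym; apply: fA.
- move=> h k hk; have [a [b [fa fb ab]]] := fE h k hk.
  exists (pr a), (pr b); rewrite !fpr; split => //.
  apply: contract_proj_adj ab _; apply: contraTneq hk => e.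
  by rewrite -fa -fb -(fpr a) -(fpr b) /pr e adj_irr.
Qed.

(* [D] is the union of the branch sets, the branch set of [h] being the fiber
   of [f] over [h] inside [D]. *)
Lemma minor_of_map (H G : sgraph) (D : {pred G}) (f : G -> H) :
  (forall h, exists x, [/\ x \in D, f x = h & forall y, y \in D -> f y = h ->
     connect (fun a b => [&& adj a b, a \in D, b \in D & f a == f b]) x y]) ->
  (forall h k, adj h k -> exists x y,
     [/\ x \in D, y \in D, f x = h, f y = k & adj x y]) ->
  minor H G.
Proof.
move=> fC fE.
(* Edges between branch sets of distinct non-adjacent vertices of [H] are dropped, because
   [contracts_to_fibers] has to produce exactly [H]. *)
pose ad : rel {x | x \in D} := fun u w => adj (val u) (val w) &&
  ((f (val u) == f (val w)) || adj (f (val u)) (f (val w))).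
have adS : symmetric ad.
  by move=> u w; rewrite /ad adj_sym eq_sym [adj (f _) _]adj_sym.
have adI : irreflexive ad by move=> u; rewrite /ad adj_irr.
exists (SGraph adS adI).
  by exists val; [exact: val_inj|move=> u w /andP[]].
apply: (@contracts_to_fibers H (SGraph adS adI) (fun u => f (val u))) => /=.
- by move=> h; have [x [xD fx _]] := fC h; exists (Sub x xD).
- pose e : rel {x | x \in D} := fun a b => ad a b && (f (val a) == f (val b)).
  rewrite -/e.
  have eS : connect_sym e.
    by apply: sym_connect_sym => a b; rewrite /e adS eq_sym.
  suff root h x (xD : x \in D) : (forall y, y \in D -> f y = h ->
     connect (fun a b => [&& adj a b, a \in D, b \in D & f a == f b]) x y) ->
     forall u, f (val u) = h -> connect e (Sub x xD) u.
    move=> u w fuw; have [x [xD _ /(root _ _ xD) rx]] := fC (f (val u)).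
    by apply: connect_trans (rx w (esym fuw)); rewrite eS; apply: rx.
  move=> cx u /cx -/(_ (valP u)) /connectP[p].
  elim: p x xD {cx} => [|b p IHp] a aD /=.
    move=> _ ua; suff -> : Sub a aD = u by rewrite connect0.
    exact/val_inj.
  move=> /andP[/and4P[ab _ bD fab] pp] lu.
  apply: connect_trans (IHp b bD pp lu).
  by apply: connect1; rewrite /e /ad /= ab fab.
- by move=> u w /andP[_ /orP[/eqP->|//]]; rewrite eqxx.
- move=> h k hk; have [x [y [xD yD fx fy xy]]] := fE h k hk.
  by exists (Sub x xD), (Sub y yD); split; rewrite // /ad /= xy fx fy hk orbT.
Qed.

(** * Friendship minors from stars and from paths *)

Lemma friendship_minor (s : nat) (G : sgraph) (D : {pred G})
    (f : G -> friendship s) :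
  (forall h, exists x, [/\ x \in D, f x = h & forall y, y \in D -> f y = h ->
     connect (fun a b => [&& adj a b, a \in D, b \in D & f a == f b]) x y]) ->
  (forall l, exists x y,
     [/\ x \in D, y \in D, f x = inl ord0, f y = inr l & adj x y]) ->
  (forall i, exists x y,
     [/\ x \in D, y \in D, f x = inr (i, ord0), f y = inr (i, ord_max) &
         adj x y]) ->
  minor (friendship s) G.
Proof.
move=> fC fH fL; apply: (minor_of_map fC).
have sw h k : (exists x y, [/\ x \in D, y \in D, f x = h, f y = k & adj x y]) ->
    exists x y, [/\ x \in D, y \in D, f x = k, f y = h & adj x y].
  by move=> [x [y [xD yD fx fy xy]]]; exists y, x; split; rewrite // adj_sym.
case=> [i|l] [j|m].
- by rewrite /= !ord1.
- by move=> _; rewrite [i]ord1.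
- by move=> _; rewrite [j]ord1; apply: sw.
move: l m => [i a] [j b]; rewrite /= /copies_adj /= => /andP[/eqP<-].
have ord2 (c : 'I_2) : c = ord0 \/ c = ord_max.
  by case: c => [[|[|//]] ic]; [left|right]; apply: val_inj.
by have [->|->] := ord2 a; have [->|->] := ord2 b => // _; apply: sw.
Qed.

(** The star [B] centred at [v] is the branch set of the hub, and all other branch sets are
    singletons. *)
Lemma friendship_minor_star (s : nat) (G : sgraph) (B : {set G}) (v : G)
    (q : 'I_s * 'I_2 -> G) :
  v \in B -> {in B, forall b, b != v -> adj v b} ->
  injective q ->
  (forall l, q l \notin B /\ exists2 b, b \in B & adj b (q l)) ->
  (forall i, adj (q (i, ord0)) (q (i, ord_max))) ->
  minor (friendship s) G.
Proof.
move=> vB Bv qI qB qE.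
pose f x : friendship s := if [pick l | q l == x] is Some l then inr l
                           else inl ord0.
have fq l : f (q l) = inr l.
  rewrite /f; case: pickP => [m /eqP/qI-> //|/(_ l)].
  by rewrite eqxx.
have fB x : x \in B -> f x = inl ord0.
  rewrite /f; case: pickP => // m /eqP <-.
  by rewrite (negPf (qB m).1).
pose D := [pred x | (x \in B) || (x \in codom q)].
have qD l : q l \in D by rewrite !inE codom_f orbT.
have BD x : x \in B -> x \in D by move=> xB; rewrite !inE xB.
apply: (@friendship_minor _ _ D f).
- case=> [i|l].
    exists v; split; rewrite ?fB ?BD ?[i]ord1 // => y /orP[yB _|/codomP[l ->]].
      have [->|yv] := eqVneq y v; first exact: connect0.
      by apply: connect1; rewrite Bv //= !BD // !fB // eqxx.
    by rewrite fq.
  exists (q l); split; rewrite ?fq // => y /orP[yB|/codomP[m ->]].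
    by rewrite fB.
  by rewrite fq => -[->]; apply: connect0.
- move=> l; have [_ [b bB bl]] := qB l.
  by exists b, (q l); split; [exact: BD|exact: qD|exact: fB|exact: fq|].
- move=> i; exists (q (i, ord0)), (q (i, ord_max)).
  by split; rewrite ?fq ?qD ?qE.
Qed.

(** A discrete intermediate value argument, used to find the place on a path where the number of
    neighbours met so far passes from [j] to [j.+1]. *)
Lemma nat_jump (c : nat -> nat) m j :
  c 0 = 0 -> (forall k, c k.+1 <= (c k).+1) -> j < c m ->
  exists2 k, k < m & c k = j /\ c k.+1 = j.+1.
Proof.
move=> c0 cS; elim: m => [|m IH]; first by rewrite c0.
case: (ltnP j (c m)) => [/IH[k km ck] _|cm jm]; first by exists k => //; lia.
by exists m => //; have := cS m; lia.
Qed.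

(* The branch sets are [{u}] and the segments into which the neighbours of [u]
   cut the path. *)
Lemma friendship_minor_path (s : nat) (G : sgraph) (u : G) (p : seq G) :
  0 < s -> u \notin p -> uniq p -> sorted (@adj G) p -> s.*2 <= count (adj u) p ->
  minor (friendship s) G.
Proof.
case: s => // s _ up Up Ap sp.
pose c k := count (adj u) (take k p).
have c0 : c 0 = 0 by rewrite /c take0.
have cE k : k < size p -> c k.+1 = c k + adj u (nth u p k).
  by move=> kp; rewrite /c (take_nth u) // -cats1 count_cat /= addn0.
have cS k : c k <= c k.+1 <= (c k).+1.
  case: (ltnP k (size p)) => kp; first by rewrite cE //; case: adj; lia.
  by rewrite /c !take_oversize //; lia.
have cm k l : k <= l -> c k <= c l.
  move=> /subnKC <-; elim: (l - k) => [|d IH]; first by rewrite addn0.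
  by rewrite addnS; have := cS (k + d); lia.
pose leaf j : 'I_s.+1 * 'I_2 := (inord j./2, inord (odd j)).
pose code (l : 'I_s.+1 * 'I_2) := l.1.*2 + l.2.
have code_lt l : code l < s.+1.*2.
  by case: l => [[i ii] [a ia]]; rewrite /code /=; lia.
have leafK l : leaf (code l) = l.
  case: l => [[i ii] [a ia]]; rewrite /code /leaf /=.
  by congr pair; apply: val_inj; rewrite /= inordK; lia.
have codeK j : j < s.+1.*2 -> code (leaf j) = j.
  by move=> js; rewrite /code /leaf /= !inordK; lia.
(* [c (index x p).+1] counts the neighbours of [u] up to and including [x], so its predecessor
   numbers, from 0, the segment that contains [x]. *)
pose f x : friendship s.+1 :=
  if x \in p then inr (leaf (c (index x p).+1).-1) else inl ord0.
(* The vertices of the path before the first neighbour of [u] and those beyond the first [s.+1.*2]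
   segments are discarded. *)
pose D := [pred x | (x == u) || (x \in p) && (0 < c (index x p).+1 <= s.+1.*2)].
have fu : f u = inl ord0 by rewrite /f (negPf up).
have uD : u \in D by rewrite !inE eqxx.
have fp k : k < size p -> f (nth u p k) = inr (leaf (c k.+1).-1).
  by move=> kp; rewrite /f mem_nth // index_uniq.
have pD k : k < size p -> 0 < c k.+1 <= s.+1.*2 -> nth u p k \in D.
  by move=> kp ck; rewrite !inE mem_nth // index_uniq // ck orbT.
have pos l : exists k, [/\ k < size p, c k = code l, c k.+1 = (code l).+1,
    adj u (nth u p k) & f (nth u p k) = inr l].
  have : code l < c (size p).
    by rewrite /c take_size (leq_trans (code_lt l)).
  case/nat_jump => // [k|k kp [ck ck1]]; first by have /andP[] := cS k.
  exists k; split => //; last by rewrite fp // ck1 leafK.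
  by move: (cE k kp); rewrite ck ck1; case: adj => //; lia.
apply: (@friendship_minor _ _ D f).
- case=> [i|l].
    exists u; split; rewrite ?fu ?[i]ord1 // => y /orP[/eqP-> _|].
      exact: connect0.
    by case/andP=> yp _; rewrite /f yp.
  have [k [kp ck ck1 uk fk]] := pos l.
  have kD : nth u p k \in D by apply: pD => //; have := code_lt l; lia.
  exists (nth u p k); split => // y /orP[/eqP->|/andP[yp cy]].
    by rewrite fu.
  rewrite /f yp => -[ly].
  have {ly} cy1 : c (index y p).+1 = (code l).+1.
    by rewrite -ly codeK; lia.
  rewrite -(nth_index u yp); move: cy1; rewrite -index_mem in yp.
  move: (index y p) yp => h hp ch.
  have kh : k <= h.
    by rewrite leqNgt; apply/negP => /cm; rewrite ch ck; lia.
  have : forall d, k + d < size p -> c (k + d).+1 = (code l).+1 ->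
    connect (fun a b => [&& adj a b, a \in D, b \in D & f a == f b])
      (nth u p k) (nth u p (k + d)).
    elim=> [|d IH] dp cd; first by rewrite addn0 connect0.
    have cd1 : c (k + d).+1 = (code l).+1.
      have := cm k.+1 (k + d).+1; have := cm (k + d).+1 (k + d.+1).+1; lia.
    have kdp : k + d < size p by lia.
    apply: connect_trans (IH kdp cd1) _; apply: connect1.
    have cl := code_lt l.
    rewrite (pD _ kdp) ?cd1 ?(pD _ dp) ?cd //; try lia.
    rewrite !fp // cd cd1 eqxx !andbT addnS.
    by apply: (sortedP u Ap); lia.
  by move/(_ (h - k)); rewrite subnKC //; apply.
- move=> l; have [k [kp ck ck1 uk fk]] := pos l.
  exists u, (nth u p k); split => //.
  by apply: pD => //; have := code_lt l; lia.
- move=> i; have [k [kp ck ck1 uk fk]] := pos (i, ord_max).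
  have cl := code_lt (i, ord_max); move: ck ck1 cl; rewrite /code /= => ck ck1 cl.
  have k0 : 0 < k by case: k ck {kp ck1 uk fk} => //; rewrite c0; lia.
  have kE : k.-1.+1 = k by lia.
  have k1p : k.-1 < size p by lia.
  (* Segment [2i + 1] starts at position [k]; the preceding vertex of the path is the last one of
     segment [2i], so a path edge joins the two leaves of blade [i]. *)
  exists (nth u p k.-1), (nth u p k); split => //.
  + by apply: pD => //; rewrite kE ck; lia.
  + by apply: pD => //; lia.
  + rewrite fp // kE ck addn1 /= -[X in leaf X]addn0.
    by rewrite -[_ + 0]/(code (i, ord0)) leafK.
  + by have := sortedP u Ap k.-1; rewrite kE; apply.
Qed.

(** * Sparsity of graphs without a friendship minor *)

Definition nbrs (G : sgraph) (x : G) : {set G} := [set y | adj x y].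

Lemma in_nbrs (G : sgraph) (x y : G) : (y \in nbrs x) = adj x y.
Proof. by rewrite inE. Qed.

(* The end of a longest path in [S] has all its neighbours on the path. *)
Lemma low_degree_vertex (s : nat) (G : sgraph) (S : {set G}) :
  0 < s -> minor_free (friendship s) G -> S != set0 ->
  exists2 u, u \in S & #|nbrs u :&: S| < s.*2.
Proof.
move=> s0 mf /set0Pn[u0 u0S].
suff ext m u p : #|G| - size p <= m -> all [in S] (u :: p) -> uniq (u :: p) ->
    path (@adj G) u p -> exists2 u, u \in S & #|nbrs u :&: S| < s.*2.
  by apply: (ext _ u0 [::] (leqnn _)); rewrite //= u0S.
elim: m u p => [|m IH] u p pm Sp Up Pp.
  have := max_card [in u :: p]; rewrite (card_uniqP Up) /=.
  by move: pm; rewrite leqn0 subn_eq0 leqNgt => /negP.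
have [/subsetP sub|/subsetPn[w]] := boolP (nbrs u :&: S \subset p).
  exists u; first by case/andP: Sp.
  rewrite ltnNge; apply/negP => ge; apply: mf.
  have /= /andP[up Up'] := Up.
  apply: (friendship_minor_path s0 up Up' (path_sorted Pp)).
  apply: leq_trans ge _; rewrite -size_filter; apply: leq_trans (card_size _).
  apply/subset_leq_card/subsetP => w wN; rewrite mem_filter sub // andbT.
  by case/setIP: wN; rewrite in_nbrs.
rewrite inE in_nbrs => /andP[uw wS] wp.
apply: (IH w (u :: p)) => /=.
- by move: pm; rewrite subnS; case: (_ - _).
- by rewrite wS.
- rewrite -[X in _ && X]/(uniq (u :: p)) Up andbT inE negb_or wp andbT.
  by apply: contraTneq uw => ->; rewrite adj_irr.
- by rewrite adj_sym uw.
Qed.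

Lemma card_nbrsI (G : sgraph) (x : G) (S : {set G}) :
  #|nbrs x :&: S| = \sum_(y in S) adj x y.
Proof.
rewrite -sum1_card -big_mkcondr /=; apply: eq_bigl => y.
by rewrite in_setI in_nbrs andbC.
Qed.

(** Degeneracy: deleting the vertex given by [low_degree_vertex] lowers the degree sum by twice its
    degree, which is less than [4 s]. *)
Lemma sum_degrees_le (s : nat) (G : sgraph) (S : {set G}) :
  0 < s -> minor_free (friendship s) G ->
  \sum_(x in S) #|nbrs x :&: S| <= 4 * s * #|S|.
Proof.
move=> s0 mf; have [m] := ubnP #|S|; elim: m S => // m IH S Sm.
have [->|S0] := eqVneq S set0; first by rewrite big_set0.
have [u uS du] := low_degree_vertex s0 mf S0.
have Su : #|S| = #|S :\ u|.+1 by rewrite (cardsD1 u S) uS.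
have := IH (S :\ u); rewrite Su in Sm => /(_ Sm).
have -> : \sum_(x in S) #|nbrs x :&: S| =
    (#|nbrs u :&: S|).*2 + \sum_(x in S :\ u) #|nbrs x :&: (S :\ u)|.
  rewrite (big_setD1 u uS) /= -addnn -addnA; congr addn.
  rewrite [in RHS]card_nbrsI (big_setD1 u uS) /= adj_irr add0n -big_split /=.
  apply: eq_bigr => x xS; rewrite !card_nbrsI (big_setD1 u uS) /=.
  by rewrite adj_sym.
rewrite Su mulnS; lia.
Qed.

(** * Friendship minors from matchings, and vertices of high degree *)

Lemma friendship_minor_pairs (s : nat) (G : sgraph) (B : {set G}) (v : G)
    (ps rs : seq G) :
  v \in B -> {in B, forall b, b != v -> adj v b} ->
  size ps = s -> all2 (@adj G) ps rs -> uniq (ps ++ rs) ->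
  {in ps ++ rs, forall x, x \notin B /\ exists2 b, b \in B & adj b x} ->
  minor (friendship s) G.
Proof.
move=> vB Bv sp; rewrite all2E => /andP[/eqP srp adjs] U xB.
have sr : size rs = s by rewrite -srp.
pose q (l : 'I_s * 'I_2) := nth v (ps ++ rs) (l.1 + l.2 * s).
have lt (l : 'I_s * 'I_2) : l.1 + l.2 * s < size (ps ++ rs).
  by move: l => [[i ii] [a ia]]; rewrite size_cat sp sr /=; nia.
apply: (@friendship_minor_star s G B v q) => //.
- move=> l m /eqP; rewrite /q nth_uniq // => /eqP.
  move: l m => [[i ii] [[|[|//]] ia]] [[j ij] [[|[|//]] ib]] /= e;
    by congr pair; apply: val_inj => /=; lia.
- by move=> l; apply: xB; apply: mem_nth.
- move=> i; rewrite /q /= mul0n addn0 mul1n !nth_cat sp ltn_ord.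
  rewrite ltnNge leq_addl /= addnK.
  have /all_nthP - /(_ (v, v) i) := adjs.
  rewrite size_zip sp sr minnn nth_zip /= ?sp ?sr //.
  by apply.
Qed.

(** Greedy choice: each chosen element joins the forbidden set [F] while the list gets one shorter,
    so the bound on [#|F| + size l] persists. *)
Lemma choose_distinct (T : finType) (N : T -> {set T}) (l : seq T) (F : {set T}) :
  {in l, forall w, #|F| + size l <= #|N w|} ->
  exists2 bs, all2 (fun w b => b \in N w) l bs &
    uniq bs /\ {in bs, forall b, b \notin F}.
Proof.
elim: l F => [|w l IH] F Fl; first by exists [::].
have /subsetPn[b bN bF] : ~~ (N w \subset F).
  apply/negP => /subset_leq_card; have /= := Fl w (mem_head _ _); lia.
have [x xl|bs lbs [Ub bsF]] := IH (b |: F).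
  have := Fl x; rewrite inE xl orbT cardsU1 bF /= => /(_ isT); lia.
exists (b :: bs); rewrite /= ?bN //; split.
  rewrite Ub andbT; apply/negP => /bsF.
  by rewrite !inE eqxx.
move=> x; rewrite inE => /predU1P[->//|/bsF].
by rewrite !inE negb_or => /andP[].
Qed.

Lemma card_set_seq (T : finType) (l : seq T) : #|[set x in l]| <= size l.
Proof. by rewrite cardsE card_size. Qed.

(** A matching that cannot be enlarged inside [Y] has at most [2k] ends, and these meet every edge
    inside [Y]. *)
Lemma matching_or_cover (G : sgraph) (Y : {set G}) k :
  (exists ps rs, [/\ size ps = k, all2 (@adj G) ps rs, uniq (ps ++ rs) &
     {subset ps ++ rs <= Y}]) \/
  exists W : {set G}, [/\ W \subset Y, #|W| <= k.*2 &
     forall x y, x \in Y -> y \in Y -> adj x y -> (x \in W) || (y \in W)].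
Proof.
elim: k => [|k [[ps [rs [sp pr U pY]]]|[W [WY Wk Wc]]]].
- by left; exists [::], [::].
- pose W := [set x in ps ++ rs].
  have [|no] := boolP [exists x in Y :\: W, [exists y in Y :\: W, adj x y]].
    case/exists_inP=> x; rewrite !inE => /andP[xW xY].
    case/exists_inP=> y; rewrite !inE => /andP[yW yY] xy.
    left; exists (x :: ps), (y :: rs); split=> [|||z].
    + by rewrite /= sp.
    + by rewrite /= xy.
    + have /perm_uniq-> : perm_eq (x :: ps ++ y :: rs) [:: x, y & ps ++ rs].
        by rewrite perm_cons (perm_catCA ps [:: y] rs).
      rewrite /= U inE yW negb_or xW !andbT.
      by apply: contraTneq xy => ->; rewrite adj_irr.
    + rewrite inE mem_cat inE => /or4P[/eqP->//|zp|/eqP->//|zr];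
        by apply: pY; rewrite mem_cat ?zp ?zr ?orbT.
  right; exists W; split.
  + by apply/subsetP => x; rewrite inE => /pY.
  + rewrite (leq_trans (card_set_seq _)) // size_cat sp.
    by move: pr; rewrite all2E => /andP[/eqP<- _]; rewrite sp; lia.
  + move=> x y xY yY xy; apply: contraR no; rewrite negb_or => /andP[xW yW].
    apply/exists_inP; exists x; first by rewrite in_setD xW.
    by apply/exists_inP; exists y; first by rewrite in_setD yW.
- by right; exists W; split => //; lia.
Qed.

Lemma sub_all2 (T S : Type) (r r' : T -> S -> bool) (l : seq T) (k : seq S) :
  (forall x y, r x y -> r' x y) -> all2 r l k -> all2 r' l k.
Proof.
by move=> rr'; elim: l k => [|x l IH] [|y k] //= /andP[/rr'-> /IH].
Qed.

Lemma all2_in (T S : eqType) (r : T -> S -> bool) (P : pred S) (l : seq T)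
    (k : seq S) :
  (forall x y, r x y -> P y) -> all2 r l k -> {in k, forall y, P y}.
Proof.
move=> rP; elim: l k => [|x l IH] [|y k] //= /andP[xy lk] z.
by rewrite inE => /predU1P[->|/(IH _ lk)//]; apply: rP xy.
Qed.

(* The hub of the friendship minor is [v] together with all its neighbours
   outside the chosen pairs. *)
Lemma few_high_degrees (s C : nat) (G : sgraph) (v : G) (L : {set G}) :
  minor_free (friendship s) G -> #|~: nbrs v| <= C -> v \notin L ->
  {in L, forall w, C + 3 * s + 2 <= #|nbrs w|} -> #|L| < s.
Proof.
move=> mf vC vL Ldeg; rewrite ltnNge; apply/negP => sL; apply: mf.
pose l := take s (enum L).
have sl : size l = s by rewrite size_takel // -cardE.
have lL w : w \in l -> w \in L by move/mem_take; rewrite mem_enum.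
have Ul : uniq l by apply/take_uniq/enum_uniq.
(* At most [C] neighbours of [w] are lost outside [nbrs v]. The remaining [3 s + 2] leave room to
   choose the partners off [v] and [l], and to find one more neighbour off all [2 s] chosen
   vertices. *)
have lN w : w \in l -> 3 * s + 2 <= #|nbrs w :&: nbrs v|.
  move=> /lL/Ldeg; rewrite -(cardsID (nbrs v) (nbrs w)) => le.
  have : #|nbrs w :\: nbrs v| <= #|~: nbrs v|.
    by rewrite subset_leq_card // setDE subsetIr.
  lia.
have [|bs lbs [Ub bF]] := @choose_distinct _ (fun w => nbrs w :&: nbrs v) l
    [set x in v :: l].
  move=> w /lN; have := card_set_seq (v :: l); rewrite /= sl; lia.
have bv : {in bs, forall b, adj v b}.
  by apply: all2_in lbs => w b; rewrite !inE => /andP[].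
have sb : size bs = s by move: lbs; rewrite all2E sl => /andP[/eqP].
have bl b : b \in bs -> (b != v) && (b \notin l).
  by move/bF; rewrite !inE negb_or.
have lv w : w \in l -> w != v by move/lL; apply: contraTneq => ->.
pose B := v |: (nbrs v :\: [set x in l ++ bs]).
apply: (@friendship_minor_pairs s G B v l bs) => //.
- by rewrite setU11.
- by move=> b; rewrite !inE => /predU1P[->|/andP[_ ->]//]; rewrite eqxx.
- apply: sub_all2 lbs => w b; by rewrite !inE => /andP[].
- rewrite cat_uniq Ul Ub andbT /=; apply/hasPn => b /bl /andP[].
  by [].
- move=> x; rewrite mem_cat => xlb; split.
    rewrite !inE mem_cat xlb /= orbF.
    by case/orP: xlb => [/lv//|/bl/andP[]].
  (* A partner is adjacent to [v] itself; a vertex of [l] may not be, and reaches the hub through a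
     spare common neighbour with [v]. *)
  case/orP: xlb => [xl|xb]; last by exists v; rewrite ?setU11 ?bv.
  have /subsetPn[b] : ~~ (nbrs x :&: nbrs v \subset [set y in l ++ bs]).
    apply/negP => /subset_leq_card.
    have := card_set_seq (l ++ bs); have := lN x xl.
    by rewrite size_cat sl sb; lia.
  rewrite !inE => /andP[xb vb] bn; exists b; last by rewrite adj_sym.
  by rewrite !inE bn vb orbT.
Qed.

(** With [[set v]] as hub, an edge [b c] avoiding [v |: L] is one blade, and the [s - 1] vertices of
    [L] with distinct partners give the others. The partners avoid [v], [b], [c], [L] and each
    other, whence the bound [2 s + 1]. *)
Lemma full_hub_cover (s : nat) (G : sgraph) (v : G) (L : {set G}) :
  minor_free (friendship s) G -> nbrs v = [set~ v] -> v \notin L ->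
  #|L|.+1 = s -> {in L, forall w, 2 * s + 1 <= #|nbrs w|} ->
  forall b c, adj b c -> (b \in v |: L) || (c \in v |: L).
Proof.
move=> mf Nv vL Ls Ldeg b c bc; apply: contra_notT mf.
have adjv x : x != v -> adj v x by rewrite -in_nbrs Nv !inE.
rewrite !inE !negb_or => /andP[/andP[bv bL] /andP[cv cL]].
have [|rs lrs [Ur rF]] := @choose_distinct _ (@nbrs G) (enum L)
    [set x in [:: v, b, c & enum L]].
  move=> w; rewrite mem_enum => /Ldeg; rewrite -cardE.
  have := card_set_seq [:: v, b, c & enum L]; rewrite /= -cardE; lia.
have sr : size rs = #|L|.
  by move: lrs; rewrite all2E -cardE => /andP[/eqP].
have rl x : x \in rs -> [/\ x != v, x != b, x != c & x \notin L].
  by move/rF; rewrite !inE !negb_or mem_enum => /and4P[].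
apply: (@friendship_minor_pairs s G [set v] v (b :: enum L) (c :: rs)).
- by rewrite inE.
- by move=> x /set1P->; rewrite eqxx.
- by rewrite /= -cardE.
- by rewrite /= bc; apply: sub_all2 lrs => w x; rewrite in_nbrs.
- rewrite cat_uniq; apply/and3P; split.
  + by rewrite /= mem_enum bL enum_uniq.
  + apply/hasPn => x; rewrite inE => /predU1P[->|/rl[_ xb _ xL]];
      rewrite /= inE mem_enum negb_or; last by rewrite xb.
    by rewrite cL andbT; apply: contraTneq bc => ->; rewrite adj_irr.
  + by rewrite /= Ur andbT; apply/negP => /rl[_ _ /eqP].
- move=> x xp; have xv : x != v.
    move: xp; rewrite mem_cat !inE mem_enum.
    case/orP => [/predU1P[->//|]|/predU1P[->//|/rl[]//]].
    by apply: contraTneq => ->.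
  by rewrite inE xv; split => //; exists v; rewrite ?inE ?adjv.
Qed.

Lemma sum_nbrsI (G : sgraph) (Z : {set G}) :
  \sum_(w : G) #|nbrs w :&: Z| = \sum_(z in Z) #|nbrs z|.
Proof.
under eq_bigr => w _ do rewrite card_nbrsI.
rewrite exchange_big /=; apply: eq_bigr => z _.
rewrite -[nbrs z]setIT card_nbrsI.
by apply: eq_big => w; rewrite ?inE // adj_sym.
Qed.

(* All edges off [v] meet the union [Z] of the set [L] of high degree vertices,
   the set [W] covering a maximal matching of [nbrs v :\: L], and the at most
   [C] vertices not adjacent to [v]. *)
Lemma nbr_degree_sum (s C K : nat) (G : sgraph) (v : G)
    (L := [set w : G | (w != v) && (K <= #|nbrs w|)]) :
  minor_free (friendship s) G -> #|~: nbrs v| <= C ->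
  \sum_(w in nbrs v) #|nbrs w| <=
    #|nbrs v| + 2 * #|L| * #|G| + 2 * K * (2 * s + C).
Proof.
move=> mf vC.
have [[ps [rs [sp pr U pY]]]|[W [WY Ws Wc]]] :=
    matching_or_cover (nbrs v :\: L) s.
  case: mf; apply: (@friendship_minor_pairs s G [set v] v ps rs) => //.
  - by rewrite inE.
  - by move=> x /set1P->; rewrite eqxx.
  move=> x /pY; rewrite in_setD in_nbrs => /andP[_ vx].
  split; last by exists v; rewrite ?inE.
  by rewrite inE; apply: contraTneq vx => ->; rewrite adj_irr.
pose T := (W :|: (~: nbrs v :\ v)) :\: L; pose Z := L :|: T.
have degZ : \sum_(z in Z) #|nbrs z| <= #|L| * #|G| + K * (2 * s + C).
  have dis : [disjoint L & T].
    rewrite disjoints_subset; apply/subsetP => z zL.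
    by rewrite in_setC in_setD zL.
  rewrite (eq_bigl [predU L & T]); last by move=> z; rewrite in_setU.
  rewrite bigU //=; apply: leq_add.
    by rewrite -sum_nat_const; apply: leq_sum => z _; apply: max_card.
  apply: (@leq_trans (\sum_(z in T) K)).
    apply: leq_sum => z; rewrite !inE => /andP[nL zT].
    rewrite leqNgt; apply: contra nL => Kz; rewrite (ltnW Kz) andbT.
    case/orP: zT => [/(subsetP WY)|/andP[]//].
    by rewrite !inE => /andP[_]; apply: contraTneq => ->; rewrite adj_irr.
  rewrite sum_nat_const mulnC leq_mul2l; apply/orP; right.
  apply: leq_trans (subset_leq_card (subsetDl _ _)) _.
  apply: leq_trans (leq_card_setU _ _) _; apply: leq_add; first lia.
  exact: leq_trans (subset_leq_card (subsetDl _ _)) vC.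
(* The summand 1 stands for the edge to [v]. Any other edge at [w] has an end in [Z]: the second
   summand serves when this is [w], the third when it is the other end. *)
have pt w : w \in nbrs v ->
    #|nbrs w| <= 1 + ((w \in Z) * #|nbrs w| + #|nbrs w :&: Z|).
  move=> vw; case: (boolP (w \in Z)) => wZ; first by lia.
  rewrite mul0n add0n -(cards1 v) (leq_trans _ (leq_card_setU _ _)) //.
  apply/subset_leq_card/subsetP => x; rewrite in_nbrs => wx.
  have [->|xv] := eqVneq x v; first by rewrite !inE eqxx.
  suff xZ : x \in Z by rewrite in_setU in_setI in_nbrs wx xZ orbT.
  move: wZ; rewrite in_setU in_setD in_setU !negb_or => /andP[wL].
  rewrite wL negb_or => /andP[wW _].
  rewrite in_setU in_setD in_setU in_setD1 in_setC xv /=.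
  have [//|xL] /= := boolP (x \in L).
  have [vx|] := boolP (x \in nbrs v); last by rewrite orbT.
  rewrite orbF.
  by have := Wc w x; rewrite !in_setD wL xL vw vx wx (negPf wW) /=; apply.
apply: (@leq_trans (\sum_(w in nbrs v)
    (1 + ((w \in Z) * #|nbrs w| + #|nbrs w :&: Z|)))); first exact: leq_sum.
rewrite big_split sum_nat_const muln1 -addnA leq_add2l.
apply: (@leq_trans (\sum_w ((w \in Z) * #|nbrs w| + #|nbrs w :&: Z|))).
  by rewrite [X in _ <= X](bigID [in nbrs v]) leq_addr.
rewrite big_split /= sum_nbrsI.
have -> : \sum_w (w \in Z) * #|nbrs w| = \sum_(w in Z) #|nbrs w|.
  rewrite [RHS]big_mkcond; apply: eq_bigr => w _.
  by case: (w \in Z); rewrite ?mul1n ?mul0n.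
apply: leq_trans (leq_add degZ degZ) _.
by rewrite -[2 * _ * _]mulnA -[2 * K * _]mulnA -mulnDr [X in _ <= X]mul2n -addnn.
Qed.

(** * From a dominant vertex to a cover of all edges by [s] vertices *)

Lemma nbrs_full (G : sgraph) (v : G) : #|~: nbrs v| <= 1 -> nbrs v = [set~ v].
Proof.
move=> c1; have vN : v \in ~: nbrs v by rewrite in_setC in_nbrs adj_irr.
apply: setC_inj; rewrite setCK; apply/esym/eqP.
by rewrite eqEcard sub1set vN cards1.
Qed.

(** The hypotheses bound [d (n - d)] by a multiple of [s n], and one of the two factors is at least
    [n / 2]. The generous [300 s^2] is chosen to serve also as the bound [C] in the case [d <= 16 s]
    below. *)
Lemma dominant_degree_cases (s n d S : nat) :
  0 < s -> 0 < d < n -> S <= 4 * s * n ->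
  d * (2 * n + 4 * s) <= 2 * S + 2 * d * d + 5 * d ->
  d <= 16 * s \/ n - d <= 300 * s * s.
Proof.
move=> s0 /andP[d0 dn] Sn H; case: (leqP (2 * d) n) => dn2.
  left; suff : d * (n - 1) <= 16 * s * (n - 1) by rewrite leq_pmul2r; lia.
  nia.
right; suff : d * (2 * (n - d)) <= d * (16 * s + 5) by rewrite leq_pmul2l; nia.
nia.
Qed.

(* The hypothesis on [v] says that [deg v + m v >= n + 2 s - 5/2], where [m v]
   is the average degree of the neighbours of [v]. *)
Lemma edge_cover_of_dominant_vertex (s n : nat) (G : sgraph) (v : G)
    (C := 300 * s * s) (K := C + 3 * s + 2) :
  0 < s -> minor_free (friendship s) G -> #|G| = n ->
  4 * K * (2 * s + C) + 4 * s * C + 2 * C + 4 * s + 5 <= n ->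
  0 < #|nbrs v| ->
  #|nbrs v| * (2 * n + 4 * s) <= 2 * (\sum_(w in nbrs v) #|nbrs w|)
    + 2 * #|nbrs v| * #|nbrs v| + 5 * #|nbrs v| ->
  exists2 A : {set G}, #|A| = s &
    forall x y, adj x y -> (x \in A) || (y \in A).
Proof.
move=> s0 mf Gn nbig d0 H.
have cC (w : G) : #|nbrs w| + #|~: nbrs w| = n by rewrite cardsC Gn.
have deg_lt (w : G) : #|nbrs w| < n.
  rewrite -(cC w) -addn1 leq_add2l card_gt0; apply/set0Pn.
  by exists w; rewrite in_setC in_nbrs adj_irr.
pose L (w : G) := [set u | (u != w) && (K <= #|nbrs u|)].
have LE w : w \notin L w by rewrite inE eqxx.
have Lcard w : #|~: nbrs w| <= C -> #|L w| < s.
  move=> wC; apply: (few_high_degrees mf wC (LE w)) => u.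
  by rewrite inE => /andP[].
have cover w : #|~: nbrs w| <= 1 -> #|L w|.+1 = s ->
    exists2 A : {set G}, #|A| = s &
      forall x y, adj x y -> (x \in A) || (y \in A).
  move=> w1 Ls; exists (w |: L w); first by rewrite cardsU1 LE.
  apply: (full_hub_cover mf (nbrs_full w1) (LE w) Ls) => u.
  rewrite inE => /andP[_]; apply: leq_trans; rewrite /K; lia.
have SG : \sum_(w in nbrs v) #|nbrs w| <= 4 * s * n.
  have := sum_degrees_le [set: G] s0 mf; rewrite cardsT Gn; apply: leq_trans.
  rewrite [X in _ <= X](bigID [in nbrs v]) /=.
  apply: leq_trans (leq_addr _ _); apply: eq_leq.
  by apply: eq_big => w; rewrite ?inE ?setIT.
have dn := deg_lt v; have := cC v.
move: H SG; set S := \sum_(w in _) _; set d := #|nbrs v| in d0 dn *.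
move=> H SG vn.
have d0n : 0 < d < n by rewrite d0.
case: (dominant_degree_cases s0 d0n SG H) => [ds|dC].
  (* The other neighbours of [v] contribute at most [n - 1] each to [S], so [w] has to make up the
     rest: [n - #|nbrs w| <= d^2 + 3d/2 + 1], which is at most [281 s^2] for [d <= 16 s]. *)
  have nbr_deg w : w \in nbrs v -> #|~: nbrs w| <= C /\
      (d = 1 -> S = #|nbrs w|).
    move=> vw; have dE : d = #|nbrs v :\ w|.+1.
      by rewrite /d (cardsD1 w (nbrs v)) vw.
    have SE : S = #|nbrs w| + \sum_(u in nbrs v :\ w) #|nbrs u|.
      by rewrite /S (big_setD1 w vw).
    have : \sum_(u in nbrs v :\ w) #|nbrs u| <= (d - 1) * (n - 1).
      rewrite dE subn1 -sum_nat_const; apply: leq_sum => u _.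
      by have := deg_lt u; lia.
    have := cC w; move: SE H; move: (\sum_(u in _) _) => T SE H wn Tn.
    split=> [|d1]; last by move: Tn; rewrite d1; lia.
    have {Tn} : S <= #|nbrs w| + (d - 1) * (n - 1) by rewrite SE leq_add2l.
    rewrite /C; clear - H wn ds d0 dn s0; nia.
  have /card_gt0P[w vw] := d0.
  have [wC w1] := nbr_deg w vw; have Lw := Lcard w wC.
  (* Every neighbour of [v] has large degree, so all of them except [w] lie in [L w]; hence
     [d <= s]. *)
  have dL : d <= #|L w|.+1.
    rewrite -(add1n #|L w|) -[1](cards1 w) (leq_trans _ (leq_card_setU _ _)) //.
    apply/subset_leq_card/subsetP => u vu; rewrite !inE.
    case: eqP => //= _; have [uC _] := nbr_deg u vu; have := cC u; lia.
  have Sd : S <= d * (n - 1).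
    rewrite -sum_nat_const; apply: leq_sum => u _; have := deg_lt u; lia.
  (* Inserting [S <= d (n - 1)] in [H] gives [4 s <= 2 d + 3], which together with [d <= s] leaves
     only this case. *)
  have [s1 d1] : s = 1 /\ d = 1.
    clear - H Sd dL Lw d0 s0 dn; nia.
  apply: (cover w); last by lia.
  have := cC w; move: H; rewrite (w1 d1) d1 s1; lia.
have vC : #|~: nbrs v| <= C by rewrite /C; lia.
have Sle := nbr_degree_sum K mf vC; have Ls := Lcard v vC.
rewrite -/(L v) -/S -/d Gn in Sle.
move: (#|L v|) (#|~: nbrs v|) (cover v) Ls Sle vC vn => l r cov ls Sle vC vn.
have r0 : 0 < r by lia.
have sr : s * r <= s * C by rewrite leq_mul2l vC orbT.
have dr : d * 1 <= d * r by rewrite leq_mul2l r0 orbT.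
rewrite -!mulnA in nbig Sle; move: (K * (2 * s + C)) nbig Sle => E nbig Sle.
(* With [n = d + r], the two estimates of [S] combine to [2 d r + 4 s d <= 7 d + 4 l n + 4 E]. As
   [r] and [E] are bounded and [n] is large, comparing the coefficients of [d] excludes first
   [l <= s - 2], then [r >= 2]. *)
have [ls1|ls1] := ltnP l.+1 s.
  have ln : (l + 2) * n <= s * n by rewrite leq_mul2r addn2 ls1 orbT.
  exfalso; move: vC sr nbig; clearbody C => vC sr nbig.
  clear - H Sle vn ln sr dr nbig vC; subst n; nia.
apply: cov; last by lia.
rewrite leqNgt; apply/negP => r1.
have dr2 : d * 2 <= d * r by rewrite leq_mul2l r1 orbT.
have sE : s = l.+1 by lia.
move: vC sr nbig; clearbody C => vC sr nbig.
clear - H Sle vn sE sr dr2 nbig vC; subst n s; nia.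
Qed.

Local Open Scope ring_scope.

(** * The signless Laplacian acting on functions of the vertices *)

Section Spectral.
Variable R : realType.

Definition signless_act (G : sgraph) (z : G -> R) (v : G) : R :=
  #|nbrs v|%:R * z v + \sum_(w in nbrs v) z w.

Lemma signless_act_mx (G : sgraph) (x : 'rV[R]_#|G|) (v : G) :
  (x *m signless_laplacian R G) 0 (enum_rank v) =
  signless_act (fun w => x 0 (enum_rank w)) v.
Proof.
rewrite /signless_laplacian mulmxDr mxE mul_mx_diag !mxE enum_rankK mulrC.
congr (_ * _ + _).
  by congr (_%:R); apply: eq_card => w; rewrite !inE.
rewrite [RHS]big_mkcond (reindex (@enum_rank G)) /=; last first.
  exact: onW_bij (enum_rank_bij G).
apply: eq_bigr => w _; rewrite mxE !enum_rankK in_nbrs adj_sym.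
by case: adj; rewrite ?mulr1 ?mulr0.
Qed.

Lemma eigenvalue_signless_act (G : sgraph) (a : R) :
  eigenvalue (signless_laplacian R G) a <->
  exists2 z : G -> R, exists v, z v != 0 & forall v, signless_act z v = a * z v.
Proof.
split=> [/eigenvalueP[x xa /rV0Pn[i xi]]|[z [v zv] za]].
  exists (fun v => x 0 (enum_rank v)).
    by exists (enum_val i); rewrite enum_valK.
  by move=> v; rewrite -signless_act_mx xa mxE.
apply/eigenvalueP; exists (\row_i z (enum_val i)).
  apply/rowP => i; rewrite -[i]enum_valK signless_act_mx !mxE enum_rankK -za.
  rewrite /signless_act mxE enum_rankK; congr (_ + _).
  by apply: eq_bigr => w _; rewrite mxE enum_rankK.
by apply/rV0Pn; exists (enum_rank v); rewrite mxE enum_rankK.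
Qed.

Lemma eigenvalue_iso (G H : sgraph) (a : R) : iso G H ->
  eigenvalue (signless_laplacian R H) a ->
  eigenvalue (signless_laplacian R G) a.
Proof.
case=> f [g fK gK] fadj /eigenvalue_signless_act[z [v zv] za].
apply/eigenvalue_signless_act; exists (z \o f).
  by exists (g v); rewrite /= gK.
have fN u w : (w \in nbrs u) = (f w \in nbrs (f u)) by rewrite !in_nbrs fadj.
move=> u; rewrite /= -za /signless_act; congr (_%:R * _ + _).
  rewrite -(card_imset _ (can_inj fK)); apply: eq_card => w.
  apply/imsetP/idP => [[x xu ->]|]; first by rewrite -fN.
  by rewrite -{1}[w]gK -fN => xu; exists (g w).
rewrite [RHS](reindex f) /=; last by exists g => w _; rewrite ?fK ?gK.
by apply: eq_bigl => w; rewrite fN.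
Qed.

Lemma iso_sym (G H : sgraph) : iso G H -> iso H G.
Proof.
case=> f [g fK gK] fadj; exists g; first by exists f.
by move=> x y; rewrite -fadj !gK.
Qed.

Lemma qrad_iso (G H : sgraph) : (0 < #|G|)%N -> iso G H -> qrad R G = qrad R H.
Proof.
move=> G0 GH; have H0 : (0 < #|H|)%N.
  by have [f /bij_eq_card <- _] := GH.
have [eG mG] := qradP R G0; have [eH mH] := qradP R H0.
apply/le_anti; rewrite (mG _ (eigenvalue_iso GH eH)) andbT.
exact: mH (eigenvalue_iso (iso_sym GH) eG).
Qed.

(* Take the entrywise absolute values of an eigenvector. *)
Lemma subeigenvector (G : sgraph) (a : R) :
  eigenvalue (signless_laplacian R G) a ->
  exists2 y : G -> R, (forall v, 0 <= y v) /\ (exists v, 0 < y v) &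
    forall v, a * y v <= signless_act y v.
Proof.
case/eigenvalue_signless_act => z [v zv] za; exists (fun v => `|z v|).
  by split=> //; exists v; rewrite normr_gt0.
move=> w; apply: (@le_trans _ _ `|a * z w|).
  by rewrite normrM ler_wpM2r // ler_norm.
rewrite -za /signless_act; apply: le_trans (ler_normD _ _) _.
by rewrite normrM normr_nat lerD2l ler_norm_sum.
Qed.

(* Evaluate the inequality at a vertex maximizing [y v / deg v]. *)
Lemma dominant_vertex (G : sgraph) (y : G -> R) (t : R) :
  0 < t -> (forall v, 0 <= y v) -> (exists v, 0 < y v) ->
  (forall v, t * y v <= signless_act y v) ->
  exists2 v : G, (0 < #|nbrs v|)%N &
    #|nbrs v|%:R * t <=
      (\sum_(w in nbrs v) #|nbrs w|)%:R + #|nbrs v|%:R * #|nbrs v|%:R.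
Proof.
move=> t0 y0 [u0 yu0] yt.
have isol v : #|nbrs v| = 0%N -> y v = 0.
  move=> d0; have := yt v; rewrite /signless_act d0 mul0r add0r.
  rewrite (cards0_eq d0) big_set0 => le; apply/eqP; rewrite eq_le y0 andbT.
  by rewrite -(pmulr_rle0 _ t0).
have degp v : 0 < y v -> (0 < #|nbrs v|)%N.
  by move=> yv; rewrite lt0n; apply: contraTneq yv => /isol ->; rewrite ltxx.
(* At an isolated vertex the quotient is 0 by the convention for division by zero, which is harmless
   since [y] vanishes there. *)
pose r v : R := y v / #|nbrs v|%:R.
have [v _ vmax] := @Order.TotalTheory.arg_maxP _ _ _ u0 predT r isT.
have r0 : 0 < r v.
  apply: lt_le_trans (vmax u0 isT).
  by rewrite divr_gt0 // ltr0n degp.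
have d0 : (0 < #|nbrs v|)%N.
  by move: r0; rewrite /r lt0n; case: eqP => // ->; rewrite invr0 mulr0 ltxx.
have yE w : y w <= #|nbrs w|%:R * r v.
  have [d|d] := posnP #|nbrs w|; first by rewrite isol // d mul0r.
  by rewrite mulrC -ler_pdivrMr ?ltr0n //; apply: vmax.
exists v => //; rewrite -(ler_pM2r r0).
have yv : y v = #|nbrs v|%:R * r v.
  by rewrite /r mulrC divfK // pnatr_eq0 -lt0n.
have -> : #|nbrs v|%:R * t * r v = t * y v by rewrite yv; ring.
apply: le_trans (yt v) _; rewrite /signless_act yv addrC mulrDl mulrA lerD2r.
by rewrite natr_sum mulr_suml; apply: ler_sum.
Qed.

End Spectral.

(** * The extremal graph and comparison with its eigenvector *)

Section Extremal.
Variable R : realType.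

Lemma signless_actE (G : sgraph) (z : G -> R) v :
  signless_act z v = \sum_(w in nbrs v) (z v + z w).
Proof. by rewrite /signless_act big_split /= sumr_const mulr_natl. Qed.

Lemma signless_act_adjoint (G : sgraph) (y z : G -> R) :
  \sum_v z v * signless_act y v = \sum_v y v * signless_act z v.
Proof.
rewrite /signless_act; under eq_bigr do rewrite mulrDr.
under [RHS]eq_bigr do rewrite mulrDr.
rewrite !big_split /=; congr (_ + _); first by apply: eq_bigr => v _; ring.
under eq_bigr do rewrite mulr_sumr big_mkcond.
under [RHS]eq_bigr do rewrite mulr_sumr big_mkcond.
rewrite exchange_big /=; apply: eq_bigr => v _; apply: eq_bigr => w _.
by rewrite !in_nbrs adj_sym; case: ifP => //; rewrite mulrC.
Qed.

(* In the join of [K_s] on [A] with an edgeless graph off [A]. *)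
Definition join_nbrs (T : finType) (A : {set T}) (v : T) : {set T} :=
  if v \in A then [set~ v] else A.

(* The characteristic equation of the quotient matrix of the partition of
   [join (complete s) (compl (complete (n - s)))] into its two sides. *)
Definition join_char (s n : nat) (t : R) : Prop :=
  (t - n%:R - s%:R + 2) * (t - s%:R) = s%:R * (n%:R - s%:R).

(** An eigenvector of the join, constant on both sides: the eigenvalue equation off [A] holds for
    every [t], and the one on [A] amounts to [join_char]. *)
Definition join_vector (T : finType) (A : {set T}) (t : R) (v : T) : R :=
  if v \in A then t - #|A|%:R else #|A|%:R.

Lemma join_vectorP (T : finType) (A : {set T}) (t : R) (v : T) :
  join_char #|A| #|T| t ->
  \sum_(w in join_nbrs A v) (join_vector A t v + join_vector A t w) =
    t * join_vector A t v.
Proof.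
rewrite /join_char /join_nbrs => tE.
have [vA|vA] := boolP (v \in A); last first.
  under eq_bigr => w wA do rewrite /join_vector wA (negPf vA) addrC subrK.
  by rewrite sumr_const /join_vector (negPf vA) mulr_natr.
rewrite (bigID [in A]) /=.
have -> : \sum_(w in [set~ v] | w \in A)
    (join_vector A t v + join_vector A t w) =
    2 * (t - #|A|%:R) * (#|A|%:R - 1).
  rewrite (eq_bigl [in A :\ v]) => [|w]; last by rewrite !inE.
  under eq_bigr => w.
    rewrite in_setD1 => /andP[_ wA]; rewrite /join_vector vA wA; over.
  rewrite sumr_const -[LHS]mulr_natr.
  have -> : #|A|%:R = 1 + #|A :\ v|%:R :> R by rewrite (cardsD1 v A) vA natrD.
  by ring.
have -> : \sum_(w in [set~ v] | w \notin A)
    (join_vector A t v + join_vector A t w) = t * (#|T|%:R - #|A|%:R).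
  rewrite (eq_bigl [in ~: A]) => [|w]; last first.
    by rewrite !inE; case: eqP => // ->; rewrite vA.
  under eq_bigr => w.
    rewrite in_setC => wA; rewrite /join_vector vA (negPf wA) subrK; over.
  by rewrite sumr_const -(cardsC A) natrD -[LHS]mulr_natr; ring.
rewrite /join_vector vA; apply/eqP; rewrite -subr_eq0; apply/eqP.
transitivity (- ((t - #|T|%:R - #|A|%:R + 2) * (t - #|A|%:R)
   - #|A|%:R * (#|T|%:R - #|A|%:R))); first by ring.
by rewrite tE subrr oppr0.
Qed.

Lemma cover_nbrs (G : sgraph) (A : {set G}) :
  (forall x y, adj x y -> (x \in A) || (y \in A)) ->
  forall v, nbrs v \subset join_nbrs A v.
Proof.
move=> Ac v; apply/subsetP => w; rewrite in_nbrs /join_nbrs => vw.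
case: (boolP (v \in A)) (Ac v w vw) => // _ _; rewrite !inE.
by apply: contraTneq vw => ->; rewrite adj_irr.
Qed.

(** Pairing [y] with the positive vector [z] of the join gives two nonnegative sums that are
    opposite by symmetry of the operator, so every term vanishes. Thus [y] is an eigenvector, and no
    edge of the join is missing at a vertex where [y] is positive. *)
Lemma subeigenvector_join (G : sgraph) (A : {set G}) (t : R) (y : G -> R) :
  (forall x y, adj x y -> (x \in A) || (y \in A)) ->
  (0 < #|A|)%N -> #|A|%:R < t -> join_char #|A| #|G| t ->
  (forall v, 0 <= y v) -> (exists v, 0 < y v) ->
  (forall v, t * y v <= signless_act y v) ->
  forall v, nbrs v = join_nbrs A v.
Proof.
move=> Ac A0 tA tE y0 [u0 yu0] yt.
have AR0 : (0 : R) < #|A|%:R by rewrite ltr0n.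
pose z := join_vector A t.
have z0 v : 0 < z v.
  by rewrite /z /join_vector; case: ifP => _; rewrite ?subr_gt0.
have zt v : \sum_(w in join_nbrs A v) (z v + z w) = t * z v.
  exact: join_vectorP.
have split_z v : t * z v =
    signless_act z v + \sum_(w in join_nbrs A v :\: nbrs v) (z v + z w).
  rewrite -zt signless_actE (big_setID (nbrs v)) /=.
  by rewrite (setIidPr (cover_nbrs Ac v)).
have zz0 v w : 0 < z v + z w by rewrite addr_gt0.
have act_z_le v : signless_act z v <= t * z v.
  by rewrite split_z lerDl sumr_ge0 // => w _; apply: ltW.
have full v : signless_act z v = t * z v -> nbrs v = join_nbrs A v.
  move=> e; apply/eqP; rewrite eqEsubset (cover_nbrs Ac) /=.
  move: (split_z v); rewrite -e -[LHS]addr0 => /addrI/esym/psumr_eq0P H.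
  apply/subsetP => w wJ; apply: contraT => wN.
  have := zz0 v w; rewrite H ?ltxx //; first by move=> x _; apply: ltW.
  by rewrite in_setD wN.
have ge1 v : 0 <= z v * (signless_act y v - t * y v).
  by rewrite mulr_ge0 ?subr_ge0 // ltW.
have ge2 v : 0 <= y v * (t * z v - signless_act z v).
  by rewrite mulr_ge0 ?subr_ge0.
have le1 : 0 <= \sum_v z v * (signless_act y v - t * y v) by apply: sumr_ge0.
have le2 : 0 <= \sum_v y v * (t * z v - signless_act z v) by apply: sumr_ge0.
have eq12 : \sum_v z v * (signless_act y v - t * y v) =
    - \sum_v y v * (t * z v - signless_act z v).
  rewrite -sumrN.
  under eq_bigr do rewrite mulrBr.
  under [RHS]eq_bigr do rewrite mulrBr opprB.
  rewrite !sumrB signless_act_adjoint; congr (_ - _).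
  by apply: eq_bigr => v _; ring.
have s1 : \sum_v z v * (signless_act y v - t * y v) = 0.
  by apply/le_anti; rewrite le1 eq12 oppr_le0 le2.
have s2 : \sum_v y v * (t * z v - signless_act z v) = 0.
  by apply: oppr_inj; rewrite oppr0 -eq12.
have y_eig v : signless_act y v = t * y v.
  have /(_ v isT)/eqP := psumr_eq0P (fun w _ => ge1 w) s1.
  by rewrite mulf_eq0 (gt_eqF (z0 v)) subr_eq0 => /eqP.
have y_full v : 0 < y v -> nbrs v = join_nbrs A v.
  move=> yv; apply: full.
  have /(_ v isT)/eqP := psumr_eq0P (fun w _ => ge2 w) s2.
  by rewrite mulf_eq0 (gt_eqF yv) subr_eq0 => /eqP.
(* If [y w] were 0, the eigenvalue equation at [w] would make [y] vanish on all neighbours of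
   [w]. *)
have y_adj v w : 0 < y v -> adj v w -> 0 < y w.
  move=> yv vw; rewrite lt_def y0 andbT.
  apply: contraTneq yv => yw; rewrite -leNgt.
  have := y_eig w; rewrite signless_actE yw mulr0 (bigD1 v) /=; last first.
    by rewrite in_nbrs adj_sym.
  rewrite add0r => <-; rewrite lerDl sumr_ge0 // => x _.
  by rewrite add0r.
(* The vertex [u0] has all its neighbours in the join, among them every other vertex of [A]. So no
   edge is missing at [A], and every edge of the join meets [A]. *)
have yA a : a \in A -> 0 < y a.
  move=> aA; have [->//|au] := eqVneq a u0.
  apply: (y_adj _ _ yu0); rewrite -in_nbrs (y_full _ yu0) /join_nbrs.
  by case: ifP; rewrite ?inE.
move=> v; have [vA|vA] := boolP (v \in A); first exact: y_full (yA v vA).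
apply/eqP; rewrite eqEsubset (cover_nbrs Ac) /join_nbrs (negPf vA).
apply/subsetP => a aA; rewrite in_nbrs adj_sym -in_nbrs (y_full _ (yA a aA)).
by rewrite /join_nbrs aA !inE; apply: contraNneq vA => ->.
Qed.

Lemma join_iso (G : sgraph) (A : {set G}) (s n : nat) :
  #|A| = s -> #|G| = n -> (forall v, nbrs v = join_nbrs A v) ->
  iso G (join (complete s) (compl (complete (n - s)))).
Proof.
move=> As Gn AJ; apply: iso_sym.
have Bs : #|~: A| = (n - s)%N by rewrite -Gn -(cardsC A) As addKn.
pose g (x : join (complete s) (compl (complete (n - s)))) : G :=
  match x with
  | inl i => enum_val (cast_ord (esym As) i)
  | inr j => enum_val (cast_ord (esym Bs) j)
  end.
have gA x : (g x \in A) = if x is inl _ then true else false.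
  case: x => i; first exact: enum_valP.
  by have := enum_valP (cast_ord (esym Bs) i); rewrite in_setC => /negPf.
have gI : injective g.
  move=> x y; have := gA x; have := gA y; case: x y => i [] j gj gi e.
  - by congr inl; apply: (@cast_ord_inj _ _ (esym As)); apply: enum_val_inj.
  - by move: gi; rewrite e gj.
  - by move: gi; rewrite e gj.
  - by congr inr; apply: (@cast_ord_inj _ _ (esym Bs)); apply: enum_val_inj.
exists g.
  apply: (inj_card_bij gI); rewrite /= card_sum !card_ord Gn -Gn -(cardsC A).
  by rewrite As addKn.
move=> x y; rewrite -in_nbrs AJ /join_nbrs gA.
case: x => i; last by rewrite gA; case: y => //= j; rewrite /compl_adj andbN.
by rewrite !inE (inj_eq gI) eq_sym; case: y.
Qed.

Lemma join_eigenvalue (s n : nat) (t : R) :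
  (0 < s < n)%N -> join_char s n t ->
  eigenvalue (signless_laplacian R
    (join (complete s) (compl (complete (n - s))))) t.
Proof.
move=> /andP[s0 sn] tE; set H := join _ _.
pose A : {set H} := [set x | if x is inl _ then true else false].
have As : #|A| = s.
  rewrite -[RHS]card_ord -(card_codom (@inl_inj 'I_s 'I_(n - s))).
  apply: eq_card => x; rewrite inE; apply/idP/codomP => [|[i ->]//].
  by case: x => // i; exists i.
have Hn : #|H| = n by rewrite /= card_sum !card_ord subnKC // ltnW.
apply/eigenvalue_signless_act; exists (join_vector A t).
  have m0 : (0 < n - s)%N by rewrite subn_gt0.
  exists (inr (Ordinal m0)); rewrite /join_vector inE As pnatr_eq0.
  by rewrite -lt0n.
move=> v; rewrite signless_actE -join_vectorP ?As ?Hn //; apply: eq_bigl => w.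
rewrite in_nbrs /join_nbrs !inE; case: v w => i [] j; rewrite !inE //=.
  by rewrite eq_sym.
by rewrite /compl_adj andbN.
Qed.

(** Intermediate values between [n + 2s - 5/2] and [n + 2s - 2], where the characteristic polynomial
    equals [2s^2 - 3s - n/2 + 5/4] and [2s(s - 1)]. Any root will do: being an eigenvalue, it bounds
    [qrad] of the join from below. *)
Lemma join_char_root (s n : nat) : (0 < s)%N -> (4 * s * s + 8 <= n)%N ->
  exists2 t : R, join_char s n t & n%:R + 2 * s%:R - 5 / 2 <= t.
Proof.
move=> s0 sn.
pose p : {poly R} := ('X - (n%:R + s%:R - 2)%:P) * ('X - s%:R%:P)
  - (s%:R * (n%:R - s%:R))%:P.
have pE x : p.[x] = (x - n%:R - s%:R + 2) * (x - s%:R) - s%:R * (n%:R - s%:R).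
  by rewrite /p hornerD hornerN hornerM !hornerXsubC hornerC; ring.
have s1 : (1 : R) <= s%:R by rewrite ler1n.
have n1 : 4 * s%:R * s%:R + 8 <= n%:R :> R by rewrite -!natrM -natrD ler_nat.
have ab : n%:R + 2 * s%:R - 5 / 2 <= n%:R + 2 * s%:R - 2 :> R by lra.
have [|t /andP[t1 _] pt] := @poly_ivt _ p _ _ ab.
  by rewrite !pE; apply/andP; split; nra.
exists t => //; rewrite /join_char; apply/eqP; rewrite -subr_eq0 -pE.
exact: pt.
Qed.

End Extremal.

(** * Assembly of the bound and of the equality case *)

Theorem corollary1p1 (R : realType) (s : nat) (hs : (1 <= s)%N) :
  exists n0 : nat, forall n : nat, (n0 <= n)%N ->
  forall G : sgraph, #|G| = n -> minor_free (friendship s) G ->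
    qrad R G <= qrad R (join (complete s) (compl (complete (n - s)))) /\
    (qrad R G = qrad R (join (complete s) (compl (complete (n - s)))) <->
     iso G (join (complete s) (compl (complete (n - s))))).
Proof.
pose C := (300 * s * s)%N; pose K := (C + 3 * s + 2)%N.
exists (4 * K * (2 * s + C) + 4 * s * C + 2 * C + 4 * s + 8)%N.
move=> n nbig G Gn mf; set J := join _ _.
have sn : (4 * s * s + 8 <= n)%N.
  by apply: leq_trans nbig; rewrite /C; clear; nia.
have sn1 : (0 < s < n)%N by rewrite hs; nia.
have n0 : (0 < n)%N by lia.
have [t tE tbig] := join_char_root R hs sn.
have J0 : (0 < #|J|)%N by rewrite /= card_sum !card_ord; lia.
have tJ : t <= qrad R J by apply: (qradP R J0).2; apply: join_eigenvalue.
have G0 : (0 < #|G|)%N by rewrite Gn.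
(* This single implication yields both claims: isomorphic graphs have equal radii, so [qrad R G]
   cannot exceed [qrad R J], and equality forces an isomorphism. *)
suff ext : qrad R J <= qrad R G -> iso G J.
  have [JG|GJ] := leP (qrad R J) (qrad R G).
    have GJ := ext JG; have e := qrad_iso R G0 GJ.
    by rewrite e lexx; split; last split.
  split; first exact: ltW.
  by split=> [e|/(qrad_iso R G0)//]; rewrite e ltxx in GJ.
move=> JG; have [y [y0 y1] yq] := subeigenvector (qradP R G0).1.
have yt v : t * y v <= signless_act y v.
  by apply: le_trans (yq v); rewrite ler_wpM2r // (le_trans tJ).
have sR : (1 : R) <= s%:R by rewrite ler1n.
have nR : 8 <= n%:R - s%:R :> R by rewrite lerBrDr -natrD ler_nat; nia.
have st : s%:R < t by lra.
have t0 : 0 < t by lra.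
have [v d0 vt] := dominant_vertex t0 y0 y1 yt.
have [||A As Ac] := edge_cover_of_dominant_vertex hs mf Gn _ d0.
- by apply: leq_trans nbig; rewrite leq_add2l.
(* The inequality at [v] with [t >= n + 2s - 5/2] is doubled to become one between natural
   numbers. *)
- rewrite -(ler_nat R) !natrD !natrM natrD !natrM.
  have dR : (0 : R) <= #|nbrs v|%:R by [].
  have := ler_wpM2l dR tbig; lra.
apply: (join_iso As Gn); apply: (subeigenvector_join Ac _ _ _ y0 y1 yt).
- by rewrite As.
- by rewrite As.
- by rewrite As Gn.
Qed.
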